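(* Let $\Sigma$ be a finite alphabet, $k\ge 1$, and $L\subseteq\Sigma^*$. Then $L$ is a $\Sigma^0_k$ language if and only if $L=\mathcal{L}(M)$ for some $\Sigma_k$ alternating Turing machine $M$ over $\Sigma$; and $L$ is a $\Pi^0_k$ language if and only if $L=\mathcal{L}(M)$ for some $\Pi_k$ alternating Turing machine $M$ over $\Sigma$.
   Context: **Alternating Turing machines.** Let $\Sigma$ be a finite alphabet. The symbols $\sqcup$ (blank), $+$ (cursor forward) and $-$ (cursor backward) are reserved (in particular they are not in $\Sigma$). An *alternating Turing machine (ATM) over $\Sigma$* is a device $M$ consisting of: disjoint finite sets $E$ (existential states) and $U$ (universal states), with $Q = E\cup U$ the set of states; a start state $s_0\in Q$; a finite alphabet $\Gamma \supseteq \Sigma\cup\{\sqcup\}$; and a relation $\delta\subseteq (Q\times\Gamma)\times(A\times Q)$, where $A=\Gamma\cup\{-,+\}$ is the set of actions. There are no designated accepting or rejecting states. A *configuration* is a tuple $(q,u,\gamma,v)$ with $q\in Q$, $u,v\in\Gamma^*$, $\gamma\in\Gamma$ ($\gamma$ is the scanned symbol). It is existential or universal according to whether $q\in E$ or $q \in U$. The yield relation $\Rightarrow$ is the least relation such that ($\varepsilon$ is the empty string): if $(q,\gamma,+,q')\in\delta$ then $(q,u,\gamma,\tau v)\Rightarrow(q',u\gamma,\tau,v)$ and $(q,u,\gamma,\varepsilon)\Rightarrow(q',u\gamma,\sqcup,\varepsilon)$; if $(q,\gamma,-,q')\in\delta$ then $(q,u\tau,\gamma,v)\Rightarrow(q',u,\tau,\gamma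 v)$ and $(q,\varepsilon,\gamma,v)\Rightarrow(q',\varepsilon,\gamma,v)$; if $(q,\gamma,\tau,q')\in\delta$ with $\tau\in\Gamma$ then $(q,u,\gamma,v)\Rightarrow(q',u,\tau,v)$. **Global acceptance.** Write $c\to_\exists c'$ when $c\Rightarrow c'$ and $c$ is existential, and $c\twoheadrightarrow_\exists c'$ when $c\to_\exists^* c'$ (reflexive-transitive closure) and $c'$ is universal. Dually, $c\to_\forall c'$ when $c\Rightarrow c'$ and $c$ is universal, and $c\twoheadrightarrow_\forall c'$ when $c\to_\forall^* c'$ and $c'$ is existential. The set $AC$ of *accepted configurations* is the least set such that: (1) if $c$ is existential and $c'\in AC$ for some $c'$ with $c\twoheadrightarrow_\exists c'$, then $c\in AC$; (2) if $c$ is universal and $c'\in AC$ for all $c'$ with $c\twoheadrightarrow_\forall c'$, then $c\in AC$. The initial configuration for input $w\in\Sigma^*$ is $(s_0,\varepsilon,\sqcup,w)$. $M$ *accepts* $w$ if this configuration is in $AC$, and $\mathcal{L}(M)=\{w\in\Sigma^*\mid M\text{ accepts }w\}$. **Computation trees and $\Sigma_k$, $\Pi_k$ machines.** The computation tree of $M$ for input $w$ is the (finitely branching, possibly infinite) tree of configuration-occurrences whose root is the initial configuration for $w$ and in which the children of a node with configuration $c$ are the configurations $c'$ with $c\Rightarrow c'$. An *alternation-pivot* on a branch is a non-root node whose configuration has a different type (existential/universal) from that of its parent. An ATM $M$ is *$\Sigma_k$* if its start state is existential and, for every $w\in\Sigma^*$, every branch of the computation tree for $w$ has at most $k$ alternation-pivots.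 *$\Pi_k$* machines are defined in the same way but with a universal start state; for $\Pi_1$ machines it is moreover posited that existential states have no applicable transition rules. **Arithmetical hierarchy.** $\Sigma^0_k$ and $\Pi^0_k$ are the usual levels of the arithmetical hierarchy for languages: $L$ is $\Sigma^0_k$ if it is definable from a decidable relation by a prefix of $k$ alternating blocks of (string or number) quantifiers starting with $\exists$; $L$ is $\Pi^0_k$ if the prefix starts with $\forall$ (equivalently, if its complement is $\Sigma^0_k$). *)

(* Defs.v *)
From mathcomp Require Import all_boot.
From Stdlib Require Import Relations.

Set Implicit Arguments.
Unset Strict Implicit.
Unset Printing Implicit Defensive.

(** ** Tapes *)

(* [(u, g, v)]: [u] is the part left of the cursor, [g] the scanned symbol, [v]
   the part right of it; both [u] and [v] are read from left to right. *)
Definition tape (G : Type) : Type := (seq G * G * seq G)%type.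

Definition scanned (G : Type) (t : tape G) : G := t.1.2.

(* The actions are the disjoint union of the tape symbols and {-, +}. *)
Inductive action (G : Type) : Type :=
  | Write of G
  | Forward
  | Backward.
Arguments Forward {G}.
Arguments Backward {G}.

(* The tape is infinite to the right only: moving backward at the left end
   leaves it unchanged. *)
Definition act (G : Type) (blank : G) (a : action G) (t : tape G) : tape G :=
  let: (u, g, v) := t in
  match a with
  | Write g' => (u, g', v)
  | Forward => if v is g' :: v' then (rcons u g, g', v')
               else (rcons u g, blank, [::])
  | Backward => if u is x :: u' then (belast x u', last x u', g :: v)
                else ([::], g, v)
  end.

(** ** Alternating Turing machines *)

(* [emb] presents the tape alphabet as a superset of Sigma together with the
   blank symbol, which is [emb None]. *)
Record atm (Sigma : finType) : Type := ATM {
  atm_E : finType;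
  atm_U : finType;
  atm_start : atm_E + atm_U;
  atm_G : finType;
  atm_emb : option Sigma -> atm_G;
  atm_emb_inj : injective atm_emb;
  atm_delta : atm_E + atm_U -> atm_G -> action atm_G -> atm_E + atm_U -> bool
}.

Section ATM.
Variables (Sigma : finType) (M : atm Sigma).

Definition state : Type := (atm_E M + atm_U M)%type.
Definition config : Type := (state * tape (atm_G M))%type.

Definition ex_state (q : state) : bool := if q is inl _ then true else false.
Definition existential (c : config) : bool := ex_state c.1.
Definition universal (c : config) : bool := ~~ existential c.

Definition yields (c c' : config) : Prop :=
  exists2 a : action (atm_G M),
    atm_delta c.1 (scanned c.2) a c'.1 & c'.2 = act (atm_emb M None) a c.2.

Definition step_ex (c c' : config) : Prop := yields c c' /\ existential c.
Definition step_un (c c' : config) : Prop := yields c c' /\ universal c.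

Definition reach_ex (c c' : config) : Prop :=
  clos_refl_trans config step_ex c c' /\ universal c'.
Definition reach_un (c c' : config) : Prop :=
  clos_refl_trans config step_un c c' /\ existential c'.

Inductive AC : config -> Prop :=
  | AC_ex c c' : existential c -> reach_ex c c' -> AC c' -> AC c
  | AC_un c : universal c -> (forall c', reach_un c c' -> AC c') -> AC c.

Definition init (w : seq Sigma) : config :=
  (atm_start M, ([::], atm_emb M None, [seq atm_emb M (Some x) | x <- w])).

Definition accepts (w : seq Sigma) : Prop := AC (init w).

(* A branch is a maximal path from the root of the computation tree; [b i] is
   the configuration at depth [i], or [None] beyond the leaf ending a finite
   branch. *)
Definition branch (w : seq Sigma) (b : nat -> option config) : Prop :=
  b 0 = Some (init w) /\
  forall i, match b i, b i.+1 with
            | Some c, Some c' => yields c c'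
            | Some c, None => forall c', ~ yields c c'
            | None, Some _ => False
            | None, None => True
            end.

(* The node at depth [i.+1] is an alternation-pivot. *)
Definition pivot (b : nat -> option config) (i : nat) : bool :=
  if (b i, b i.+1) is (Some c, Some c') then existential c != existential c'
  else false.

Definition pivots_le (k : nat) : Prop :=
  forall w b, branch w b -> forall n, count (pivot b) (iota 0 n) <= k.

Definition is_Sigma (k : nat) : Prop :=
  ex_state (atm_start M) /\ pivots_le k.

Definition is_Pi (k : nat) : Prop :=
  [/\ ~~ ex_state (atm_start M), pivots_le k &
      k = 1 -> forall (q : state) g a q', ex_state q -> ~~ atm_delta q g a q'].

End ATM.

(** ** Decidable relations *)

(* Deterministic single-tape machines with input alphabet Theta; a state [q]
   with [tm_verdict q = Some b] is halting, and accepting iff [b]. *)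
Record tm (Theta : finType) : Type := TM {
  tm_Q : finType;
  tm_start : tm_Q;
  tm_G : finType;
  tm_emb : option Theta -> tm_G;
  tm_emb_inj : injective tm_emb;
  tm_verdict : tm_Q -> option bool;
  tm_delta : tm_Q -> tm_G -> action tm_G * tm_Q
}.

Section TM.
Variables (Theta : finType) (T : tm Theta).

Definition tm_config : Type := (tm_Q T * tape (tm_G T))%type.

Definition tm_init (z : seq Theta) : tm_config :=
  (tm_start T, ([::], tm_emb T None, [seq tm_emb T (Some x) | x <- z])).

Definition tm_step (c : tm_config) : tm_config :=
  if tm_verdict c.1 is Some _ then c
  else let: (a, q') := tm_delta c.1 (scanned c.2) in
       (q', act (tm_emb T None) a c.2).

Definition tm_halts_with (b : bool) (z : seq Theta) : Prop :=
  exists n, tm_verdict (iter n tm_step (tm_init z)).1 = Some b.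

End TM.

(* The tuple (w, x_1, ..., x_n) is presented to a machine as the string
   w # x_1 # ... # x_n, with # := None. *)
Definition encode (Sigma Delta : finType) (w : seq Sigma)
    (xs : seq (seq Delta)) : seq (option (Sigma + Delta)) :=
  [seq Some (inl a) | a <- w]
  ++ flatten [seq None :: [seq Some (inr d) | d <- x] | x <- xs].

Definition decidable_rel (Sigma Delta : finType) (n : nat)
    (R : seq Sigma -> seq (seq Delta) -> Prop) : Prop :=
  exists T : tm (option (Sigma + Delta)),
  forall w xs, size xs = n ->
  exists2 b, tm_halts_with T b (encode w xs) & (b <-> R w xs).

(** ** The arithmetical hierarchy *)

(* Prefix of alternating quantifier blocks of lengths [ns], starting with an
   existential one iff [ex]; [xs] accumulates the values chosen so far. *)
Fixpoint quantify (X : Type) (ex : bool) (ns : seq nat)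
    (P : seq X -> Prop) (xs : seq X) : Prop :=
  if ns is n :: ns' then
    if ex then exists ys : n.-tuple X, quantify false ns' P (xs ++ ys)
    else forall ys : n.-tuple X, quantify true ns' P (xs ++ ys)
  else P xs.

(* The quantifiers range over the strings over an auxiliary finite alphabet
   Delta; a number is a string over a one-letter alphabet. *)
Definition arith_level (ex : bool) (Sigma : finType) (k : nat)
    (L : seq Sigma -> Prop) : Prop :=
  exists (Delta : finType) (ns : seq nat) (R : seq Sigma -> seq (seq Delta) -> Prop),
  [/\ size ns = k, 0 \notin ns, decidable_rel (sumn ns) R &
      forall w, L w <-> quantify ex ns (R w) [::]].

Definition Sigma0 (Sigma : finType) (k : nat) (L : seq Sigma -> Prop) : Prop :=
  arith_level true k L.
Definition Pi0 (Sigma : finType) (k : nat) (L : seq Sigma -> Prop) : Prop :=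
  arith_level false k L.

(* Main.v *)
Require Import Defs.
From HB Require Import structures.
From mathcomp Require Import all_boot.
From mathcomp Require Import boolp.
From Stdlib Require Import Relations.

(* Acceptance is a game in which the owner of the current phase ([true] for
   existential, [false] for universal) must leave the phase, after finitely many
   steps, at a configuration she wins; a phase that never ends is lost by its
   owner.  A quantifier prefix is the same kind of game, with strings as moves.

   From a machine to a formula, the i-th string is the list of transitions
   performed in the i-th phase.  The decider interprets M along these lists, and
   a player who writes an illegal list loses.  The simulated tape is a second
   track: the word w # x_1 # ... # x_n starts where M expects w, so it
   suffices to read every cell after w as blank on that track.

   From a formula to a machine, the phases guess the strings behind the input,
   the machine then runs the decider inside the last phase, and its owner makes
   one more alternation exactly when she likes the verdict. *)

Set Implicit Arguments.
Unset Strict Implicit.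
Unset Printing Implicit Defensive.

(** * Tapes as functions on positions *)

Section Tape.
Variables (G : Type) (blank : G).
Implicit Types (t : tape G) (p : nat) (f : nat -> G) (a : action G).

(** The blank is the default value of [nth], so tapes that differ only by trailing blanks represent
    the same [p] and [f]. *)
Definition rep t p f : Prop :=
  size t.1.1 = p /\ forall i, nth blank (t.1.1 ++ t.1.2 :: t.2) i = f i.

Definition act_pos a p : nat :=
  match a with Write _ => p | Forward => p.+1 | Backward => p.-1 end.

Definition act_cont a p f : nat -> G :=
  if a is Write g then fun i => if i == p then g else f i else f.

Lemma act_cont_id p f : act_cont (Write (f p)) p f =1 f.
Proof. by move=> i /=; case: eqP => [->|]. Qed.

Lemma rep_scanned t p f : rep t p f -> scanned t = f p.
Proof.
case: t => [[u g] v] [/= <- <-].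
by rewrite nth_cat ltnn subnn.
Qed.

Lemma rep_ext t p f f' : f =1 f' -> rep t p f -> rep t p f'.
Proof. by move=> ff' [tp tf]; split=> // i; rewrite tf. Qed.

Lemma rep_act a t p f :
  rep t p f -> rep (act blank a t) (act_pos a p) (act_cont a p f).
Proof.
case: t => [[u g] v] [/= <- tf].
case: a => [g'||] /=.
- split=> //= i; rewrite nth_cat -tf nth_cat /=.
  case: ltngtP => // [ui|->]; last by rewrite subnn.
  by rewrite -[i - _]prednK ?subn_gt0.
- case: v tf => [|g' v] tf; split; rewrite /= ?size_rcons // => i.
    rewrite -tf cat_rcons !nth_cat; case: ltnP => // _.
    by case: (i - size u) => [|[|j]] //=; rewrite nth_nil.
  by rewrite -tf cat_rcons.
- case: u tf => [|x u] tf; split; rewrite /= ?size_belast // => i.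
  by rewrite -tf -cat_rcons -lastI.
Qed.

Lemma rep_start z :
  rep ([::], blank, z) 0 (fun i => nth blank (blank :: z) i).
Proof. by split. Qed.

End Tape.

Lemma clos_rt_sub (A : Type) (R S : A -> A -> Prop) x y :
  (forall u v, R u v -> S u v) ->
  clos_refl_trans A R x y -> clos_refl_trans A S x y.
Proof.
move=> RS; elim=> [u v /RS|u|u v w _ uv _]; first exact: rt_step.
  exact: rt_refl.
exact: rt_trans uv.
Qed.

(** * Acceptance as a game *)

Section Game.
Variables (Sigma : finType) (M : atm Sigma).
Implicit Types (c : config M) (b : bool).

Definition step b c c' : Prop := yields c c' /\ existential c = b.

(** The universal player wins exactly where acceptance fails, so the game is determined by
    definition. *)
Definition win b c : Prop := if b then Defs.AC c else ~ Defs.AC c.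

Lemma winN b c : win (~~ b) c <-> ~ win b c.
Proof. by case: b => //=; split=> [|/contrapT]; auto. Qed.

(** Being inductive, this forces the owner [b] to leave her phase after finitely many steps. *)
Inductive attractor b c : Prop :=
  | attr_pivot c' of step b c c' & existential c' = ~~ b & win b c'
  | attr_step c' of step b c c' & existential c' = b & attractor b c'.

Lemma attractor_path b c :
  attractor b c <->
  exists c', [/\ existential c = b, clos_refl_trans _ (step b) c c',
                 existential c' = ~~ b & win b c'].
Proof.
split=> [|[c' [cb cc' c'b wc']]].
  elim=> {c} [c c' cc' c'b wc'|c c' cc' c'b _ [c2 [_ c'c2 c2b wc2]]].
    by exists c'; split=> //; [case: cc' | apply: rt_step].
  exists c2; split=> //; first by case: cc'.
  by apply: rt_trans c'c2; apply: rt_step.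
move: c'b; have {}cc' := clos_rt_rt1n _ _ _ _ cc'.
elim: cc' cb wc' => {c c'} [c -> _|c c1 c' cc1 c1c' IH cb wc' c'b].
  by case: b.
case: (boolP (existential c1 == b)) => [/eqP c1b|].
  by apply: attr_step (IH c1b wc' c'b).
move=> c1b'; have c1b : existential c1 = ~~ b.
  by move: c1b'; case: existential; case: (b).
apply: (attr_pivot (c' := c1)) => //.
(* No [step b] starts at a configuration of the other type, so the path ends here. *)
case: c1c' wc' => [//|c2 c3 [_ c1b2]].
by move/eqP: c1b2; rewrite c1b; case: (b).
Qed.

(** For the existential player this is [AC_ex]; for the universal one it is [AC_un] read
    contrapositively. *)
Lemma win_attractor b c : existential c = b -> win b c <-> attractor b c.
Proof.
move=> cb; rewrite attractor_path; case: b cb => /= cb.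
  split=> [ac|[c' [_ cc' c'u ac']]].
    case: ac cb => [{}c c' _ [cc' c'u] ac' cb|{}c]; last first.
      by rewrite /universal => /negbTE ->.
    by exists c'; split=> //; apply/negbTE.
  by apply: AC_ex ac' => //; split=> //; rewrite /universal c'u.
split=> [nac|[c' [_ cc' c'e nac']] ac].
  apply: contrapT => H; apply: nac; apply: AC_un; rewrite /universal ?cb //.
  move=> c' [cc' c'e]; apply: contrapT => nac'; apply: H; exists c'; split=> //.
  suff: clos_refl_trans _ (step false) c c' by [].
  by apply: clos_rt_sub cc' => x y [xy xu]; split=> //; apply/negbTE.
case: ac cb cc' => [{}c c2 ce _ _|{}c cu H cb cc']; first by rewrite ce.
apply/nac'/H; split=> //.
by apply: clos_rt_sub cc' => x y [xy xu]; split=> //; rewrite /universal xu.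
Qed.

Lemma win_step b c : existential c = b ->
  win b c <-> exists2 c', yields c c' & win b c'.
Proof.
move=> cb; split=> [/(win_attractor cb)|[c' cc' wc']].
  case=> c' [cc' _] c'b; first by exists c'.
  by move=> ac'; exists c'; rewrite ?win_attractor.
apply/win_attractor => //; case: (eqVneq (existential c') b) => c'b.
  by apply: (@attr_step _ _ c') => //; apply/win_attractor.
apply: (@attr_pivot _ _ c') => //.
by case: b {cb wc'} c'b; case: existential.
Qed.

End Game.

(* The alternation [quantify] seen as a game for the player [b] who moves next:
   both quantifiers become "there is a move losing for the opponent". *)
Fixpoint game (X : Type) (b : bool) (ns : seq nat) (P : seq X -> Prop)
    (xs : seq X) : Prop :=
  if ns is n :: ns' then
    exists2 ys, size ys = n & ~ game (~~ b) ns' P (xs ++ ys)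
  else if b then P xs else ~ P xs.

Lemma game_quantify (X : Type) b ns (P : seq X -> Prop) xs :
  game b ns P xs <-> if b then quantify b ns P xs else ~ quantify b ns P xs.
Proof.
elim: ns b xs => [|n ns IH] b xs /=; first by case: b.
case: b; split.
- case=> ys /eqP sy H; exists (Tuple sy); apply: contrapT => /= nq.
  by apply: H; apply/IH.
- by case=> ys q; exists ys; rewrite ?size_tuple // => /IH /=.
- by case=> ys /eqP sy H q; apply: H; apply/IH; apply: (q (Tuple sy)).
- by move=> /existsNP[ys nq]; exists ys; rewrite ?size_tuple // => /IH /=.
Qed.

Lemma game_cons (X : Type) b n ns (P : seq X -> Prop) xs : 0 < n ->
  game b (n :: ns) P xs <->
  exists z ys, size ys = n.-1 /\ ~ game (~~ b) ns P (xs ++ z :: ys).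
Proof.
case: n => // n _; split=> [[[//|z ys] [sy] H]|[z [ys [sy H]]]].
  by exists z, ys.
by exists (z :: ys); rewrite //= sy.
Qed.

(** Settles the game once a player has broken the rules; [x0] only fills the blocks that the winner
    must still choose. *)
Lemma game_const (X : Type) (x0 : X) b ns (P : seq X -> Prop) xs :
  (forall ys, if b then P (xs ++ ys) else ~ P (xs ++ ys)) ->
  game b ns P xs /\ ~ game (~~ b) ns P xs.
Proof.
elim: ns b xs => [|n ns IH] b xs H.
  by move: (H [::]); rewrite cats0; case: b {H} => /=; tauto.
have {}IH ys : game b ns P (xs ++ ys) /\ ~ game (~~ b) ns P (xs ++ ys).
  by apply: IH => zs; rewrite -catA; apply: H.
split=> [|[ys _]].
  by exists (nseq n x0); rewrite ?size_nseq //; case: (IH (nseq n x0)).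
by rewrite negbK; case: (IH ys).
Qed.

(** * Machines as decidable relations *)

Section Halting.
Variables (Theta : finType) (T : tm Theta).

(** Quantifying over all tapes with content [f] lets runs be chained through pointwise equal
    contents. *)
Definition halts_at (s : tm_Q T) p (f : nat -> tm_G T) (b : bool) : Prop :=
  forall t, rep (tm_emb T None) t p f ->
  exists n, tm_verdict (iter n (@tm_step _ T) (s, t)).1 = Some b.

Lemma halts_ext s p f f' b : f =1 f' -> halts_at s p f' b -> halts_at s p f b.
Proof. by move=> ff' H t /(rep_ext ff'); apply: H. Qed.

Lemma halts_verdict s p f b : tm_verdict s = Some b -> halts_at s p f b.
Proof. by move=> sb t _; exists 0. Qed.

Lemma halts_step s p f b a s' :
  tm_verdict s = None -> tm_delta s (f p) = (a, s') ->
  halts_at s' (act_pos a p) (act_cont a p f) b -> halts_at s p f b.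
Proof.
move=> sN sf H t tp; have [n nb] := H _ (rep_act a tp); exists n.+1.
by rewrite iterSr /tm_step /= sN (rep_scanned tp) sf.
Qed.

Lemma halts_stay s p f b s' :
  tm_verdict s = None -> tm_delta s (f p) = (Write (f p), s') ->
  halts_at s' p f b -> halts_at s p f b.
Proof.
move=> sN sf H; apply: halts_step sN sf _.
by apply: halts_ext H; apply: act_cont_id.
Qed.

End Halting.

Definition action_code (G : Type) (a : action G) : option (option G) :=
  match a with
  | Write g => Some (Some g) | Forward => Some None | Backward => None
  end.
Definition action_decode (G : Type) (x : option (option G)) : action G :=
  match x with
  | Some (Some g) => Write g | Some None => Forward | None => Backward
  end.
Lemma action_codeK (G : Type) : cancel (@action_code G) (@action_decode G).
Proof. by case. Qed.
HB.instance Definition _ (G : finType) :=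
  Finite.copy (action G) (can_type (@action_codeK G)).

(* Control states of the interpreter: [b] is the type of the current phase, [q]
   the simulated state, and [o] the instruction being carried to the simulated
   head, if any. *)
Inductive ctrl (Q D : Type) : Type :=
  | Begin
  | Rewind (b : bool) (q : Q) (o : option D)
  | Seek (b : bool) (q : Q) (o : option D)
  | Move (b : bool) (d : D)
  | Mark (b : bool) (q : Q)
  | Halt (b : bool).
Arguments Begin {Q D}.
Arguments Rewind {Q D}.
Arguments Seek {Q D}.
Arguments Move {Q D}.
Arguments Mark {Q D}.
Arguments Halt {Q D}.

Definition ctrl_code (Q D : Type) (s : ctrl Q D) :
    option bool + bool * ((bool * Q * option D) + D + Q) :=
  match s with
  | Begin => inl None
  | Halt b => inl (Some b)
  | Rewind b q o => inr (b, inl (inl (true, q, o)))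
  | Seek b q o => inr (b, inl (inl (false, q, o)))
  | Move b d => inr (b, inl (inr d))
  | Mark b q => inr (b, inr q)
  end.
Definition ctrl_decode (Q D : Type)
    (x : option bool + bool * ((bool * Q * option D) + D + Q)) : ctrl Q D :=
  match x with
  | inl None => Begin
  | inl (Some b) => Halt b
  | inr (b, inl (inl (true, q, o))) => Rewind b q o
  | inr (b, inl (inl (false, q, o))) => Seek b q o
  | inr (b, inl (inr d)) => Move b d
  | inr (b, inr q) => Mark b q
  end.
Lemma ctrl_codeK (Q D : Type) : cancel (@ctrl_code Q D) (@ctrl_decode Q D).
Proof. by case. Qed.
HB.instance Definition _ (Q D : finType) :=
  Finite.copy (ctrl Q D) (can_type (@ctrl_codeK Q D)).

(** * The interpreter of transition lists *)

Section Interpreter.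
Variables (Sigma : finType) (M : atm Sigma) (b0 : bool).

Let G : finType := atm_G M.
Let blank : G := atm_emb M None.
Let Q : finType := (atm_E M + atm_U M)%type.

Definition instr : finType := (action G * Q)%type.

(** The type is tested before each instruction, so the last one may leave the phase but none may
    come after that. *)
Fixpoint follow (b : bool) (c : config M) (x : seq instr) : option (config M) :=
  if x is (a, q) :: x' then
    if (existential c == b) && atm_delta c.1 (scanned c.2) a q
    then follow b (q, act blank a c.2) x' else None
  else Some c.

(* In a separated list of transition sequences, [None] is the separator and ends
   the current phase; a player who breaks the rules in her phase loses. *)
Fixpoint exec (b : bool) (c : config M) (r : seq (option instr)) : bool :=
  match r with
  | [::] => ~~ existential c
  | None :: r' => if existential c == b then ~~ b else exec (~~ b) c r'
  | Some (a, q) :: r' =>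
      if (existential c == b) && atm_delta c.1 (scanned c.2) a q
      then exec b (q, act blank a c.2) r' else ~~ b
  end.

Lemma exec_follow b c x r :
  exec b c ([seq Some d | d <- x] ++ r) =
  if follow b c x is Some c' then exec b c' r else ~~ b.
Proof.
elim: x c => [|[a q] x IH] c //=.
by case: ifP => // _; rewrite IH.
Qed.

(* The instruction track holds [None] beyond the input, [Some None] at the cells
   of [w] and at the instructions already read. The other components are the
   simulated symbol, the mark of the simulated head and the mark of the leftmost
   cell. *)
Definition cell : finType :=
  (option (option (option instr)) * G * bool * bool)%type.

Definition track (g : cell) := g.1.1.1.
Definition sym (g : cell) : G := g.1.1.2.
Definition head_mark (g : cell) : bool := g.1.2.
Definition left_mark (g : cell) : bool := g.2.

Definition read_mark (g : cell) : cell :=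
  (Some None, sym g, head_mark g, left_mark g).
Definition set_head (h : bool) (g : cell) : cell :=
  (track g, sym g, h, left_mark g).
Definition lift_action (g : cell) (a : action G) : action cell :=
  match a with
  | Write x => Write (track g, x, head_mark g, left_mark g)
  | Forward => Forward
  | Backward => Backward
  end.

Definition cell_emb (x : option (option (Sigma + instr))) : cell :=
  match x with
  | None => (None, blank, false, false)
  | Some None => (Some (Some None), blank, false, false)
  | Some (Some (inl a)) => (Some None, atm_emb M (Some a), false, false)
  | Some (Some (inr d)) => (Some (Some (Some d)), blank, false, false)
  end.

Lemma cell_emb_inj : injective cell_emb.
Proof.
case=> [[[a|d]|]|] [[[a'|d']|]|] //= []; last by move=> ->.
by move=> /atm_emb_inj[->].
Qed.

(** One cycle: rewind, seek the first unread cell and mark it read, rewind, seek the simulated head,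
    check the transition, act, mark the new head position. A separator only switches the phase. *)
Definition interp_delta (s : ctrl Q instr) (g : cell) :
    action cell * ctrl Q instr :=
  match s with
  | Begin =>
      (Write (Some None, sym g, true, true), Rewind b0 (atm_start M) None)
  | Rewind b q o =>
      if left_mark g then (Write g, Seek b q o) else (Backward, s)
  | Seek b q None =>
      match track g with
      | None => (Write g, Halt (~~ ex_state q))
      | Some None => (Forward, s)
      | Some (Some None) =>
          if ex_state q == b then (Write g, Halt (~~ b))
          else (Write (read_mark g), Rewind (~~ b) q None)
      | Some (Some (Some d)) => (Write (read_mark g), Rewind b q (Some d))
      end
  | Seek b q (Some (a, q')) =>
      if ~~ head_mark g then (Forward, s)
      else if (ex_state q == b) && atm_delta q (sym g) a q'
      then (Write (set_head false g), Move b (a, q'))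
      else (Write g, Halt (~~ b))
  | Move b (a, q) => (lift_action g a, Mark b q)
  | Mark b q => (Write (set_head true g), Rewind b q None)
  | Halt b => (Write g, s)
  end.

Definition interp : tm (option (Sigma + instr)) :=
  @TM _ (ctrl Q instr) Begin cell cell_emb cell_emb_inj
    (fun s => if s is Halt b then Some b else None) interp_delta.

(* The tape of the interpreter when the instructions at the cells below [c] are
   read, those in [r] remain, and the simulated tape has content [h]. *)
Definition layout c (r : seq (option instr)) (h : nat -> G) (hd : pred nat) i :
    cell :=
  (if i < c then Some None else nth None [seq Some (Some x) | x <- r] (i - c),
   h i, hd i, i == 0).

Lemma layout_act c r h hd a p :
  act_cont (lift_action (layout c r h hd p) a) p (layout c r h hd)
  =1 layout c r (act_cont a p h) hd.
Proof. by case: a => //= g i; rewrite /layout; case: eqP => // ->. Qed.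

Lemma act_pos_lift g a p : act_pos (lift_action g a) p = act_pos a p.
Proof. by case: a. Qed.

Lemma track_layout c r h hd :
  track (layout c r h hd c) = nth None [seq Some (Some x) | x <- r] 0.
Proof. by rewrite /track /layout ltnn subnn. Qed.

Lemma layout_read c x r h hd :
  act_cont (Write (read_mark (layout c (x :: r) h hd c))) c
    (layout c (x :: r) h hd) =1 layout c.+1 r h hd.
Proof.
move=> i /=; case: eqP => [->|/eqP ic]; first by rewrite /layout ltnSn.
rewrite /layout [i < c.+1]ltnS [i <= c]leq_eqVlt (negPf ic) /=.
case: ltnP => // ci; rewrite (_ : i - c = (i - c.+1).+1) //.
by rewrite subnS prednK // subn_gt0 ltn_neqAle eq_sym ic.
Qed.

Lemma layout_head c r h hd p v :
  act_cont (Write (set_head v (layout c r h hd p))) p (layout c r h hd)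
  =1 layout c r h (fun i => if i == p then v else hd i).
Proof. by move=> i /=; rewrite /layout; case: eqP => // ->. Qed.

Local Notation halts := (@halts_at _ interp).

Lemma interp_rewind b q o p f v : (forall i, left_mark (f i) = (i == 0)) ->
  halts (Seek b q o) 0 f v -> halts (Rewind b q o) p f v.
Proof.
move=> fl H; elim: p => [|p IH].
  by apply: halts_stay H => //=; rewrite fl.
apply: (@halts_step _ interp _ p.+1 _ _ Backward _ _ _ IH) => //=.
by rewrite fl.
Qed.

Lemma interp_seek b q o p n f v : p <= n ->
  (forall i, i < n ->
    interp_delta (Seek b q o) (f i) = (Forward, Seek b q o)) ->
  halts (Seek b q o) n f v -> halts (Seek b q o) p f v.
Proof.
move=> pn fn H; rewrite -(subKn pn); elim: (n - p) => [|m IH].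
  by rewrite subn0.
(* For [n <= m] both truncated differences are [0], and the two goals coincide. *)
case: (ltnP m n) => [mn|nm]; last first.
  by move: nm IH => /[dup] /leqW; rewrite -!subn_eq0 => /eqP-> /eqP->.
apply: (@halts_step _ interp _ _ _ _ Forward (Seek b q o)) => //.
  by apply: fn; rewrite ltn_subrL (leq_ltn_trans (leq0n m) mn).
by rewrite /= subnSK.
Qed.

(** The invariant between two cycles, by induction on the unread list [r]; the cursor may be at any
    [p], since each cycle begins by rewinding. *)
Lemma interp_exec r b q t p0 h p c : rep blank t p0 h -> 0 < c ->
  halts (Rewind b q None) p (layout c r h (pred1 p0)) (exec b (q, t) r).
Proof.
elim: r b q t p0 h p c => [|x r IH] b q t p0 h p c tp c_gt0;
  apply: interp_rewind => //; apply: (@interp_seek _ _ _ _ c) => // [i ic|].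
- by rewrite /= /track /layout ic.
- apply: (@halts_stay _ interp _ _ _ _ (Halt (~~ ex_state q))) => //=.
    by rewrite track_layout.
  exact: halts_verdict.
- by rewrite /= /track /layout ic.
set l := layout c (x :: r) h (pred1 p0); rewrite /existential /=.
case: x @l => [[a q']|] l.
  apply: (@halts_step _ interp _ _ _ _ (Write (read_mark (l c)))
            (Rewind b q (Some (a, q')))) => //.
    by rewrite /= track_layout.
  apply: halts_ext; first exact: layout_read.
  apply: interp_rewind => //; apply: (@interp_seek _ _ _ _ p0) => // [i ip|].
    by rewrite /= /head_mark /= ltn_eqF.
  rewrite (rep_scanned tp); set l1 := layout _ _ _ _.
  have hp : head_mark (l1 p0) by rewrite /head_mark /= eqxx.
  case: ifP => qa; last first.
    apply: (@halts_stay _ interp _ _ _ _ (Halt (~~ b))) => //=.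
      by rewrite hp /= qa.
    exact: halts_verdict.
  apply: (@halts_step _ interp _ _ _ _ (Write (set_head false (l1 p0)))
            (Move b (a, q'))) => //; first by rewrite /= hp /= qa.
  apply: halts_ext; first exact: layout_head.
  apply: halts_step => //.
  apply: halts_ext; first exact: layout_act.
  rewrite act_pos_lift; apply: halts_step => //.
  apply: halts_ext; first exact: layout_head.
  have := IH b q' _ _ _ (act_pos a p0) c.+1 (rep_act a tp) isT.
  (* The old head mark has been erased and the new one set, so again exactly one cell is marked. *)
  apply: halts_ext => i; congr (_, _, _, _) => /=.
  by case: eqP => // _; case: eqP.
case: ifP => qb.
  apply: (@halts_stay _ interp _ _ _ _ (Halt (~~ b))) => //=.
    by rewrite track_layout /= qb.
  exact: halts_verdict.
apply: (@halts_step _ interp _ _ _ _ (Write (read_mark (l c)))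
          (Rewind (~~ b) q None)) => //; first by rewrite /= track_layout /= qb.
by apply: halts_ext; first exact: layout_read; apply: IH.
Qed.

Definition join_instr (xs : seq (seq instr)) : seq (option instr) :=
  flatten [seq None :: [seq Some d | d <- x] | x <- xs].

Lemma interp_halts w xs :
  tm_halts_with interp
    (exec b0 (init M w) (join_instr xs)) (encode w xs).
Proof.
(* Cell [0] is the initial blank and [w] fills the next [size w] cells, so the first unread cell is
   [(size w).+1]. *)
have := @interp_exec (join_instr xs) b0 (atm_start M) _ _ _ 0 (size w).+1
  (rep_start blank [seq atm_emb M (Some x) | x <- w]) isT.
move=> H; suff: halts Begin 0 (fun i => nth (cell_emb None)
    (cell_emb None :: [seq cell_emb (Some x) | x <- encode w xs]) i)
    (exec b0 (init M w) (join_instr xs)).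
  by apply; apply: rep_start.
apply: halts_step => //=.
apply: halts_ext H => -[|i] //=; rewrite /layout /= ltnS subSS.
rewrite /encode map_cat nth_cat !size_map; case: ltnP => iw.
  rewrite -!map_comp; case: w iw => // a w iw.
  by rewrite !(nth_map a).
rewrite [nth blank _ i]nth_default ?size_map //= (_ : i.+1 == 0 = false) //.
move: {i iw}(i - size w) => i; rewrite /join_instr.
elim: xs i => [|x xs IH] [|i] //=.
rewrite !map_cat !nth_cat !size_map; case: ltnP => ix; last exact: IH.
by case: x ix => // d x ix; rewrite -!map_comp !(nth_map d).
Qed.

End Interpreter.

(** * Counting pivots on finite paths *)

Section Reached.
Variables (Sigma : finType) (M : atm Sigma) (w : seq Sigma).

Inductive reached : config M -> nat -> Prop :=
  | reached_init : reached (init M w) 0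
  | reached_step c c' m : reached c m -> yields c c' ->
      reached c' (m + (existential c != existential c')).

(** A classical choice of successor; iterating it prolongs a finite path to a branch, as [pivots_le]
    speaks of maximal paths. *)
Definition some_succ (c : config M) : option (config M) :=
  if pselect (exists c', yields c c') is left e then Some (projT1 (cid e))
  else None.

Definition greedy (c : config M) (i : nat) : option (config M) :=
  iter i (obind some_succ) (Some c).

Lemma greedyP c i :
  match greedy c i, greedy c i.+1 with
  | Some c, Some c' => yields c c'
  | Some c, None => forall c', ~ yields c c'
  | None, Some _ => False
  | None, None => True
  end.
Proof.
rewrite /= -/(greedy c i); case: (greedy c i) => //= {}c; rewrite /some_succ.
case: pselect => [e|ne c' cc']; first exact: projT2 (cid e).
by apply: ne; exists c'.
Qed.

Lemma reached_branch c m : reached c m ->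
  exists b n, [/\ branch w b, b n = Some c & count (pivot b) (iota 0 n) = m].
Proof.
elim=> {c m} [|c c' m _ [b [n [[b0 bs] bn <-]]] cc'].
  exists (greedy (init M w)), 0; split=> //; split=> // i; exact: greedyP.
(* The old branch is kept up to [c] and continued greedily from [c']. *)
pose b' i := if i <= n then b i else greedy c' (i - n.+1).
have b'n i : i <= n -> b' i = b i by rewrite /b' => ->.
have b'c : b' n.+1 = Some c' by rewrite /b' ltnn subnn.
exists b', n.+1; split=> //.
  split=> [|i]; first by rewrite b'n.
  case: (ltngtP i n) => [lt_in|lt_ni|->].
  - rewrite (b'n _ (ltnW lt_in)) (b'n _ lt_in); exact: bs.
  - have := greedyP c' (i - n.+1).
    by rewrite /b' leqNgt lt_ni (leqNgt i.+1) ltnS (ltnW lt_ni) subSn.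
  - by rewrite b'c b'n // bn.
rewrite -addn1 iotaD count_cat /= addn0 add0n; congr (_ + _).
  apply: eq_in_count => i; rewrite mem_iota add0n /= => lt_in.
  by rewrite /pivot (b'n _ (ltnW lt_in)) (b'n _ lt_in).
by rewrite /pivot b'c b'n // bn.
Qed.

Lemma reached_pivots k c m : pivots_le M k -> reached c m -> m <= k.
Proof. by move=> Mk /reached_branch[b [n [wb _ <-]]]; apply: Mk wb n. Qed.

End Reached.

(** * Phases as strings of transitions *)

Section Follow.
Variables (Sigma : finType) (M : atm Sigma).

(** Only the last instruction of a legal list can change the type, so a list costs at most one
    pivot. *)
Lemma follow_reached w b (c c' : config M) x m : follow b c x = Some c' ->
  existential c = b -> reached w c m ->
  reached w c' (m + (existential c' != b)).
Proof.
elim: x c m => [|[a q] x IH] c m /= => [[<-] -> cm|].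
  by rewrite eqxx addn0.
case: ifP => // /andP[_ cd] + cb cm.
set c1 := (q, _) => c1c'.
have cc1 : yields c c1 by exists a.
have := reached_step cm cc1; rewrite cb.
case: (eqVneq b (existential c1)) => [c1b|c1b]; rewrite ?addn0 => rc1.
  exact: IH (esym c1b) rc1.
case: x c1c' {IH} => [[<-]|[a' q'] x] /=; first by rewrite eq_sym c1b.
by rewrite eq_sym (negPf c1b).
Qed.

Lemma attractor_follow b (c : config M) : existential c = b ->
  attractor b c <->
  exists x c', [/\ follow b c x = Some c', existential c' = ~~ b & win b c'].
Proof.
move=> cb; split=> [{cb}|[x [c' [cc' c'b wc']]]].
  elim=> {c} [[q0 t0] [q t] [[a d /= ->] cb] c'b wc'|].
    exists [:: (a, q)]; eexists; split; [|exact: c'b|exact: wc'].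
    by rewrite /= cb eqxx d.
  move=> c [q t] [[a d /= ->] cb] c'b _ [x [c' [xc' ? ?]]].
  exists ((a, q) :: x), c'; split=> //.
  by rewrite /= cb eqxx d.
elim: x c cb cc' => [|[a q] x IH] c cb /=.
  by case=> cc'; move: c'b; rewrite -cc' cb; case: (b).
case: ifP => // /andP[_ cd]; set c1 := (q, _) => c1c'.
have cc1 : step b c c1 by split=> //; exists a.
case: (eqVneq (existential c1) b) => [c1b|c1b].
  exact: attr_step cc1 c1b (IH _ c1b c1c').
case: x c1c' {IH} => [[c1c']|[a' q'] x] /=; last by rewrite (negPf c1b).
by apply: attr_pivot cc1 _ _; rewrite c1c'.
Qed.

Definition play b0 w (xs : seq (seq (instr M))) : Prop :=
  exec b0 (init M w) (join_instr xs).

(** Induction on the number [n] of strings left, [m] pivots having been used. The last hypothesis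
    says that [exec], having read [xs], is at [c] and still in the opponent's phase, which the next
    separator ends. *)
Lemma game_exec k w b0 n m b (c : config M) xs :
  pivots_le M k -> m + n = k -> reached w c m -> existential c = b ->
  (forall ys, exec b0 (init M w) (join_instr (xs ++ ys))
              = exec (~~ b) c (join_instr ys)) ->
  game b (nseq n 1) (play b0 w) xs <->
  win b c.
Proof.
move=> Mk; elim: n m b c xs => [|n IH] m b c xs mk cm cb execE.
  (* All [k] pivots are spent, so the owner cannot leave her phase and loses, in agreement with
     [exec] on the empty list. *)
  have -> : win b c <-> False.
    split=> // /(win_attractor cb)/(attractor_follow cb)[x [c' [cc' c'b _]]].
    have := reached_pivots Mk (follow_reached cc' cb cm).
    by rewrite c'b -mk addn0; case: (b); rewrite addn1 ltnn.
  have := execE [::]; rewrite cats0 /= /play cb => ->.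
  by case: (b); split=> //; apply.
rewrite (win_attractor cb) (attractor_follow cb) game_cons //=.
have exec_cons x ys : exec b0 (init M w) (join_instr (xs ++ x :: ys)) =
    if follow b c x is Some c' then exec b c' (join_instr ys) else ~~ b.
  rewrite execE /join_instr /= -/(join_instr _).
  by rewrite cb; case: (b); rewrite exec_follow.
have lost x :
    (forall ys, exec b0 (init M w) (join_instr (xs ++ x :: ys)) = ~~ b) ->
    game (~~ b) (nseq n 1) (play b0 w) (xs ++ [:: x]).
  move=> xb.
  have [|//] := @game_const _ [::] (~~ b) (nseq n 1) (play b0 w) (xs ++ [:: x]).
  by move=> ys; rewrite -catA /play xb; case: (b).
have next x c' : follow b c x = Some c' -> existential c' = ~~ b ->
  game (~~ b) (nseq n 1) (play b0 w) (xs ++ [:: x])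
  <-> win (~~ b) c'.
  move=> xc' c'b; apply: (IH (m + 1)) => //.
  - by rewrite -addnA add1n.
  - by have := follow_reached xc' cb cm; rewrite c'b; case: (b).
  - by move=> ys; rewrite -catA exec_cons xc' negbK.
split=> [[x [? [/size0nil -> ng]]]|[x [c' [xc' c'b wc']]]]; last first.
  by exists x, [::]; split=> //; rewrite (next _ _ xc' c'b) winN; apply.
case xc' : (follow b c x) => [c'|]; last first.
  by case: ng; apply: lost => ys; rewrite exec_cons xc'.
(* A legal list that stays in the phase loses as well, at the next separator or at the end of the
   list. *)
case: (eqVneq (existential c') b) => [c'b|c'b].
  case: ng; apply: lost => ys; rewrite exec_cons xc'.
  by case: ys => [|y ys] /=; rewrite c'b // eqxx.
have {}c'b : existential c' = ~~ b by move: c'b; case: existential; case: (b).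
exists x, c'; split=> //; apply: contrapT => nw; apply: ng.
by apply/(next _ _ xc' c'b)/winN.
Qed.

End Follow.

Lemma atm_arith_level (Sigma : finType) (M : atm Sigma) ex k :
  0 < k -> ex_state (atm_start M) = ex -> pivots_le M k ->
  arith_level ex k (accepts M).
Proof.
move=> k_gt0 Mex Mk; exists (instr M), (nseq k 1).
(* Each string is preceded by a separator, so [exec] starts in a fictitious phase of the other
   player, and the first separator opens the phase [ex]. *)
exists (play (M := M) (~~ ex)); split.
- by rewrite size_nseq.
- by rewrite mem_nseq k_gt0.
- exists (interp M (~~ ex)) => w xs _.
  exists (exec (~~ ex) (init M w) (join_instr xs)) => //.
  exact: interp_halts.
move=> w; have := game_exec (n := k) (b := ex) (xs := [::])
  Mk (add0n k) (reached_init M w) Mex.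
move=> /(_ (~~ ex) (fun=> erefl)); rewrite game_quantify /win /accepts.
case: (ex) => -[H1 H2]; split=> // H; apply: contrapT => nH.
  exact: H1 nH H.
exact: H2 nH H.
Qed.

(** * Quantifier prefixes as machines *)

(** Induction along a winning play of the owner inside her phase; it uses that this play is finite,
    which [win_step] does not record. *)
Lemma win_ind (Sigma : finType) (M : atm Sigma) b (P : config M -> Prop) :
  (forall c c', existential c = b -> yields c c' -> win b c' ->
     (existential c' = b -> P c') -> P c) ->
  forall c, existential c = b -> win b c -> P c.
Proof.
move=> H c cb /(win_attractor cb) ac.
elim: ac {cb} => {}c c' [cc' cb] c'b; first move=> wc'.
  by apply: (H c c') => //; rewrite c'b; case: (b).
by move=> /(win_attractor c'b) wc' Pc'; apply: (H c c').
Qed.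

(** Lets the owner of the last block keep the turn while the decider runs. *)
Lemma game_nil (X : Type) b (P : seq X -> Prop) xs :
  game b [::] P xs <-> ~ game (~~ b) [::] P xs.
Proof. by case: b => /=; split=> // H; [move/(_ H) | apply: contrapT]. Qed.

Lemma encode_rcons0 (Sigma Delta : finType) (w : seq Sigma)
    (xs : seq (seq Delta)) :
  encode w (rcons xs [::]) = rcons (encode w xs) None.
Proof. by rewrite /encode map_rcons flatten_rcons catA cats1. Qed.

Lemma encode_rcons_rcons (Sigma Delta : finType) (w : seq Sigma) xs x
    (d : Delta) :
  encode w (rcons xs (rcons x d)) =
  rcons (encode w (rcons xs x)) (Some (inr d)).
Proof.
by rewrite /encode !map_rcons !flatten_rcons /= -rcons_cons -!rcons_cat.
Qed.

(* Program points of the guessing machine; the counter is the number of strings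
   of the current block still to be started. *)
Inductive point (J Q : Type) : Type :=
  | Start
  | Enter
  | Scan
  | Advance (j : J)
  | Choose (j : J)
  | Return
  | Run (q : Q)
  | Final.
Arguments Start {J Q}.
Arguments Enter {J Q}.
Arguments Scan {J Q}.
Arguments Advance {J Q}.
Arguments Choose {J Q}.
Arguments Return {J Q}.
Arguments Run {J Q}.
Arguments Final {J Q}.

Definition point_code (J Q : Type) (l : point J Q) :
    option (option (option (option (option (bool * J + Q))))) :=
  match l with
  | Start => None
  | Enter => Some None
  | Scan => Some (Some None)
  | Return => Some (Some (Some None))
  | Final => Some (Some (Some (Some None)))
  | Advance j => Some (Some (Some (Some (Some (inl (true, j))))))
  | Choose j => Some (Some (Some (Some (Some (inl (false, j))))))
  | Run q => Some (Some (Some (Some (Some (inr q)))))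
  end.
Definition point_decode (J Q : Type)
    (x : option (option (option (option (option (bool * J + Q)))))) :
    point J Q :=
  match x with
  | None => Start
  | Some None => Enter
  | Some (Some None) => Scan
  | Some (Some (Some None)) => Return
  | Some (Some (Some (Some None))) => Final
  | Some (Some (Some (Some (Some (inl (true, j)))))) => Advance j
  | Some (Some (Some (Some (Some (inl (false, j)))))) => Choose j
  | Some (Some (Some (Some (Some (inr q))))) => Run q
  end.
Lemma point_codeK (J Q : Type) : cancel (@point_code J Q) (@point_decode J Q).
Proof. by case. Qed.
HB.instance Definition _ (J Q : finType) :=
  Finite.copy (point J Q) (can_type (@point_codeK J Q)).

(** * The guessing machine *)

Section Guesser.
Variables (Sigma Delta : finType) (ex : bool) (ns : seq nat).
Variable T : tm (option (Sigma + Delta)).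

Let k := size ns.
Let J : finType := 'I_(sumn ns).+1.
(** The boolean marks the leftmost cell, to which the cursor returns before [T] is run. *)
Let G : finType := (tm_G T * bool)%type.
Let blank : G := (tm_emb T None, false).
Let sharp : G := (tm_emb T (Some None), false).
Let letter (d : Delta) : G := (tm_emb T (Some (Some (inr d))), false).
Let loc : finType := point J (tm_Q T).

Definition ty (i : nat) : bool := ex (+) odd i.

Lemma tyS i : ty i.+1 = ~~ ty i.
Proof. by rewrite /ty /= addbN. Qed.

(** One less than the block length, because the separator that enters the block already starts its
    first string. *)
Definition block_count (i : nat) : J := inord (nth 0 ns i).-1.

Lemma block_countE i : block_count i = (nth 0 ns i).-1 :> nat.
Proof.
rewrite inordK // ltnS; apply: leq_trans (leq_pred _) _.
rewrite /J; elim: ns i => [|n ns' IH] [|i] //=; first exact: leq_addr.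
by apply: leq_trans (IH i) _; apply: leq_addl.
Qed.

Definition guess_emb (x : option Sigma) : G :=
  if x is Some a then (tm_emb T (Some (Some (inl a))), false) else blank.

Lemma guess_emb_inj : injective guess_emb.
Proof. by move=> [a|] [a'|] //= [] /tm_emb_inj // [->]. Qed.

Definition run_action (g : G) (a : action (tm_G T)) : action G :=
  match a with
  | Write x => Write (x, g.2)
  | Forward => Forward
  | Backward => Backward
  end.

(** The separator of the next block passes the turn; the last block goes on to the decider without
    an alternation. *)
Inductive closing (i : nat) (g : G) : action G -> nat -> loc -> Prop :=
  | close_block : i.+1 < k ->
      closing i g (Write sharp) i.+1 (Advance (block_count i.+1))
  | close_last : i.+1 = k -> closing i g (Write g) i Return.

(* The transitions in block [i]; block [k] is the last alternation, made when
   the verdict of [T] is the one wanted by the owner of the last block. *)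
Inductive rule (i : nat) : loc -> G -> action G -> nat -> loc -> Prop :=
  | rule_start g : rule i Start g (Write (tm_emb T None, true)) i Enter
  | rule_enter g : rule i Enter g Forward i Scan
  | rule_scan g : g.1 != tm_emb T None -> rule i Scan g Forward i Scan
  | rule_first g : g.1 = tm_emb T None ->
      rule i Scan g (Write sharp) i (Advance (block_count i))
  | rule_advance j g : rule i (Advance j) g Forward i (Choose j)
  | rule_letter j g d : rule i (Choose j) g (Write (letter d)) i (Advance j)
  | rule_next (j j' : J) g : j = j'.+1 :> nat ->
      rule i (Choose j) g (Write sharp) i (Advance j')
  | rule_close (j : J) g a i' l' : j = 0 :> nat -> closing i g a i' l' ->
      rule i (Choose j) g a i' l'
  | rule_back (g : G) : g.2 = false -> rule i Return g Backward i Return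
  | rule_back_end (g : G) : g.2 ->
      rule i Return g (Write g) i (Run (tm_start T))
  | rule_run q q' g a : tm_verdict q = None -> tm_delta q g.1 = (a, q') ->
      rule i (Run q) g (run_action g a) i (Run q')
  | rule_verdict q g : tm_verdict q = Some (ty i) ->
      rule i (Run q) g (Write g) i.+1 Final.

Lemma rule_advanceE i (j : J) g a i' l' : rule i (Advance j) g a i' l' ->
  [/\ a = Forward, i' = i & l' = Choose j].
Proof. by move=> r; inversion r. Qed.

Lemma rule_choose i (j : J) g a i' l' : rule i (Choose j) g a i' l' ->
  [\/ exists d, [/\ a = Write (letter d), i' = i & l' = Advance j],
      exists j' : J, [/\ j = j'.+1 :> nat, a = Write sharp, i' = i &
                        l' = Advance j']
    | j = 0 :> nat /\ closing i g a i' l'].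
Proof.
move=> r; inversion r; subst.
- by constructor 1; exists d.
- by constructor 2; exists j'.
- by constructor 3.
Qed.

Definition mode : finType := ('I_k.+1 * loc)%type.

(** Every mode occurs on both sides of the sum; the parity of the block selects the side, hence the
    type of the state. *)
Definition st (i : nat) (l : loc) : mode + mode :=
  if ty i then inl (inord i, l) else inr (inord i, l).

Lemma st_inj i l i' l' : i <= k -> i' <= k -> st i l = st i' l' ->
  i = i' /\ l = l'.
Proof.
move=> ik i'k; rewrite /st.
by case: ifP => _; case: ifP => _ // [/(congr1 val)]; rewrite /= !inordK.
Qed.

(** The bound [i < k] leaves block [k] without transitions, so its owner is stuck there and
    loses. *)
Definition guess_delta (s : mode + mode) (g : G) (a : action G)
    (s' : mode + mode) : bool :=
  `[< exists i l i' l',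
        [/\ i < k, rule i l g a i' l', s = st i l & s' = st i' l'] >].

Definition guesser : atm Sigma :=
  @ATM Sigma mode mode (st 0 Start) G guess_emb guess_emb_inj guess_delta.

Definition conf_at (c : config guesser) i l p f : Prop :=
  [/\ i <= k, c.1 = st i l & rep blank c.2 p f].

Lemma conf_at_ex c i l p f : conf_at c i l p f -> existential c = ty i.
Proof. by case=> _ cs _; rewrite /existential cs /st; case: ty. Qed.

Lemma conf_at_ext c i l p f f' : f =1 f' -> conf_at c i l p f ->
  conf_at c i l p f'.
Proof. by move=> ff' [? ? /(rep_ext ff')]. Qed.

Lemma rule_le i l g a i' l' : i < k -> rule i l g a i' l' -> i' <= k.
Proof.
move=> ik r; have le_ik := ltnW ik; case: r => //.
by move=> j {}g {}a {}i' {}l' _ [].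
Qed.

Lemma yields_rule c c' i l p f : conf_at c i l p f -> yields c c' ->
  exists a i' l', [/\ i < k, rule i l (f p) a i' l' &
                      conf_at c' i' l' (act_pos a p) (act_cont a p f)].
Proof.
move=> [ik cs tp] [a /asboolP[i1 [l1 [i' [l' [i1k r]]]]] cs1 c's ct].
have [] := @st_inj i l i1 l1; rewrite -?cs //; first exact: ltnW.
move=> e1 e2; move: r i1k; rewrite -{}e1 -{}e2 (rep_scanned tp) => r ik'.
exists a, i', l'; split=> //; split=> //; first exact: rule_le r.
by rewrite ct; apply: rep_act.
Qed.

Lemma rule_yields c i l p f a i' l' : conf_at c i l p f -> i < k ->
  rule i l (f p) a i' l' ->
  exists2 c', yields c c' &
              conf_at c' i' l' (act_pos a p) (act_cont a p f).
Proof.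
move=> [_ cs tp] ik r; exists (st i' l', act blank a c.2).
  exists a => //; apply/asboolP; exists i, l, i', l'; split=> //.
  by rewrite (rep_scanned tp).
by split=> //; [exact: rule_le r | exact: rep_act].
Qed.

Definition wins i l p f (X : Prop) : Prop :=
  forall c, conf_at c i l p f -> win (ty i) c <-> X.

Lemma wins_ext i l p f f' X : f =1 f' -> wins i l p f' X -> wins i l p f X.
Proof. by move=> ff' H c /(conf_at_ext ff'); apply: H. Qed.

Lemma wins_forced i l p f a l' X : i < k -> rule i l (f p) a i l' ->
  (forall a1 i1 l1, rule i l (f p) a1 i1 l1 -> [/\ a1 = a, i1 = i & l1 = l']) ->
  wins i l' (act_pos a p) (act_cont a p f) X -> wins i l p f X.
Proof.
move=> ik r uniq H c ca; rewrite (win_step (conf_at_ex ca)); split.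
  case=> c' /(yields_rule ca)[a1 [i1 [l1 [_ /uniq[-> -> ->] c'a]]]].
  by move/(H _ c'a).
move=> x; have [c' cc' c'a] := rule_yields ca ik r.
by exists c' => //; apply/(H _ c'a).
Qed.

(** On the verdict she wants, the owner alternates into block [k], where the opponent is stuck; on
    the other verdict she is stuck herself. *)
Lemma wins_run n i q t p g f v : i.+1 = k -> rep (tm_emb T None) t p g ->
  f =1 (fun x => (g x, x == 0)) ->
  tm_verdict (iter n (@tm_step _ T) (q, t)).1 = Some v ->
  wins i (Run q) p f (v = ty i).
Proof.
move=> ik; elim: n q t p g f => [|n IH] q t p g f tp fE.
  move=> /= qv c ca; rewrite (win_step (conf_at_ex ca)); split.
    case=> c' /(yields_rule ca)[a [i' [l' [_ r _]]]].
    by inversion r; congruence.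
  move=> vE; rewrite vE in qv; have ik' : i < k by rewrite -ik.
  have [c' cc' c'a] := rule_yields ca ik' (rule_verdict (f p) qv).
  exists c' => //; rewrite -[ty i]negbK -tyS winN (win_step (conf_at_ex c'a)).
  case=> c2 /(yields_rule c'a)[? [? [? []]]].
  by rewrite ik ltnn.
case qv : (tm_verdict q) => [u|].
  have -> : iter n.+1 (@tm_step _ T) (q, t) = iter n (@tm_step _ T) (q, t).
    by rewrite iterSr /tm_step /= qv.
  exact: IH tp fE.
case qd : (tm_delta q (g p)) => [a q'].
rewrite iterSr {2}/tm_step /= qv (rep_scanned tp) qd => {}/IH IH.
have fp : (f p).1 = g p by rewrite fE.
apply: (@wins_forced _ _ _ _ (run_action (f p) a) (Run q')).
- by rewrite -ik.
- by apply: rule_run => //; rewrite fp.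
- move=> a1 i1 l1 r; inversion r; subst; last by congruence.
  match goal with E : tm_delta _ _ = _ |- _ => move: E end.
  by rewrite fp qd => -[-> ->].
have := IH _ _ _ (rep_act a tp) (fun _ => erefl).
have -> : act_pos (run_action (f p) a) p = act_pos a p by case: (a).
apply: wins_ext => x; case: (a) => //= y; case: eqP => // ->.
by rewrite fE.
Qed.

(** The string [s] starts at cell [1], after the marked blank on which the cursor starts. *)
Definition content (s : seq (option (Sigma + Delta))) (x : nat) : G :=
  (tm_emb T (nth None (None :: [seq Some y | y <- s]) x), x == 0).

Lemma content_tm s x : content s x =
  (nth (tm_emb T None) (tm_emb T None :: [seq tm_emb T (Some y) | y <- s]) x,
   x == 0).
Proof.
rewrite /content; case: x => //= x; congr (_, _).
case: (ltnP x (size s)) => xs; last by rewrite !nth_default ?size_map.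
by case: s xs => // y s xs; rewrite !(nth_map y).
Qed.

Lemma content_write s y :
  act_cont (Write (tm_emb T (Some y), false)) (size s).+1 (content s) =1
  content (rcons s y).
Proof.
move=> x /=; case: eqP => [->|/eqP xs].
  by rewrite /content /= map_rcons nth_rcons size_map ltnn eqxx.
rewrite /content; case: x xs => //= x; rewrite eqSS => xs.
rewrite map_rcons nth_rcons size_map (negPf xs).
by case: ltngtP xs => // sx _; rewrite nth_default // size_map ltnW.
Qed.

Lemma content_end s : content s (size s).+1 = blank.
Proof. by rewrite /content /= nth_default ?size_map. Qed.

(** * Correctness of the guessing machine *)

Section Correctness.
Variable R : seq Sigma -> seq (seq Delta) -> Prop.
Hypothesis T_dec : forall w xs, size xs = sumn ns ->
  exists2 b, tm_halts_with T b (encode w xs) & (b <-> R w xs).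
Hypothesis ns_gt0 : 0 \notin ns.

Lemma wins_return w xs i p : size xs = sumn ns -> i.+1 = k ->
  wins i Return p (content (encode w xs)) (game (ty i) [::] (R w) xs).
Proof.
move=> sxs ik; have ik' : i < k by rewrite -ik.
have [v [n vn] vR] := T_dec w sxs.
elim: p => [|p IH].
  apply: (@wins_forced _ _ _ _ (Write _) (Run (tm_start T)) _ ik') => /=.
  - exact: rule_back_end.
  - by move=> a i1 l1 r; inversion r; subst => //; discriminate.
  apply: wins_ext; first exact: act_cont_id.
  have := wins_run ik (rep_start _ _) (content_tm _) vn.
  move=> H c ca; rewrite (H c ca) /=.
  by case: (ty i); rewrite -vR; case: (v); split=> // /(_ isT).
apply: (@wins_forced _ _ _ _ Backward Return _ ik') => //.
- exact: rule_back.
- by move=> a i1 l1 r; inversion r; subst => //; discriminate.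
Qed.

(** * A single block of guesses *)

Section Block.
Variables (i : nat) (w : seq Sigma).
Hypothesis ik : i < k.
Let rest := drop i.+1 ns.

(** The value of a completed block, supplied by the induction over blocks in [wins_block]. *)
Hypothesis wins_close : forall xs x c a i' l',
  size xs + 1 + sumn rest = sumn ns -> closing i blank a i' l' ->
  let s := encode w (rcons xs x) in
  conf_at c i' l' (act_pos a (size s).+1)
    (act_cont a (size s).+1 (content s)) ->
  win (ty i) c <-> ~ game (~~ ty i) rest (R w) (xs ++ [:: x]).

Lemma closing_ex : exists a i' l', closing i blank a i' l'.
Proof.
move: (ik); rewrite leq_eqVlt => /orP[/eqP ik'|ik'].
  by exists (Write blank), i, Return; apply: close_last.
by exists (Write sharp), i.+1, (Advance (block_count i.+1)); apply: close_block.
Qed.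

(** For [d = 0] the cursor is on the last symbol written, for [d = 1] on the blank after it. *)
Definition guess_at c (l : loc) xs x (d : nat) : Prop :=
  let s := encode w (rcons xs x) in conf_at c i l (size s + d) (content s).

Lemma guess_at_letter c j xs x d : let s := encode w (rcons xs x) in
  conf_at c i (Advance j) (size s).+1
    (act_cont (Write (letter d)) (size s).+1 (content s)) ->
  guess_at c (Advance j) xs (rcons x d) 0.
Proof.
move=> s; rewrite /guess_at addn0 encode_rcons_rcons size_rcons.
by apply: conf_at_ext => y; rewrite content_write.
Qed.

Lemma guess_at_next c j xs x : let s := encode w (rcons xs x) in
  conf_at c i (Advance j) (size s).+1
    (act_cont (Write sharp) (size s).+1 (content s)) ->
  guess_at c (Advance j) (rcons xs x) [::] 0.
Proof.
move=> s; rewrite /guess_at addn0 encode_rcons0 size_rcons.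
by apply: conf_at_ext => y; rewrite content_write.
Qed.

(** The game in the middle of a block: [z] is the rest of the current string and [ys] are the
    strings not yet started. *)
Definition completion xs x (j : nat) : Prop := exists z ys, size ys = j /\
  ~ game (~~ ty i) rest (R w) (xs ++ (x ++ z) :: ys).

Lemma completion_win xs x (j : J) c : size xs + j.+1 + sumn rest = sumn ns ->
  guess_at c (Advance j) xs x 0 -> completion xs x j -> win (ty i) c.
Proof.
suff H ys z : forall xs x (j : J) c, size xs + j.+1 + sumn rest = sumn ns ->
    guess_at c (Advance j) xs x 0 -> size ys = j ->
    ~ game (~~ ty i) rest (R w) (xs ++ (x ++ z) :: ys) -> win (ty i) c.
  by move=> sz ca [z [ys [sy ng]]]; apply: (H ys z) sz ca sy ng.
have turn c1 c' l p f : conf_at c1 i l p f -> yields c1 c' -> win (ty i) c' ->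
    win (ty i) c1.
  by move=> c1a c1c' wc'; rewrite (win_step (conf_at_ex c1a)); exists c'.
(* The owner writes down the witnesses: the outer induction is on the strings still to be started,
   the inner one on the letters still missing from the current string. *)
elim: ys z => [|y ys IHy] z; elim: z => [|d z IHz] {}xs {}x {}j {}c sz ca sy ng;
  have [c1 cc1 c1a] := rule_yields ca ik (rule_advance _ _ _);
  apply: (turn _ _ _ _ _ ca cc1);
  move: c1a; rewrite /= addn0 => c1a;
  have atE := content_end (encode w (rcons xs x)).
- have [a [i' [l' cl]]] := closing_ex.
  have := rule_close (esym sy) cl; rewrite -atE => r.
  have [c2 c12 c2a] := rule_yields c1a ik r.
  apply: (turn _ _ _ _ _ c1a c12); apply/(wins_close _ cl c2a).
    by rewrite -sz -sy.
  by move: ng; rewrite cats0.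
- have [c2 c12 c2a] := rule_yields c1a ik (rule_letter _ _ _ d).
  apply: (turn _ _ _ _ _ c1a c12).
  by apply: IHz sz (guess_at_letter c2a) sy _; rewrite cat_rcons.
- have lt_j : size ys < (sumn ns).+1.
    by rewrite (leq_trans _ (ltn_ord j)) // -sy.
  have [c2 c12 c2a] := rule_yields c1a ik
    (@rule_next _ j (Ordinal lt_j) _ (esym sy)).
  apply: (turn _ _ _ _ _ c1a c12).
  apply: (IHy y _ [::] (Ordinal lt_j) _ _ (guess_at_next c2a)) => //.
    by move: sz; rewrite size_rcons addSnnS -sy.
  by rewrite cat_rcons; move: ng; rewrite cats0.
- have [c2 c12 c2a] := rule_yields c1a ik (rule_letter _ _ _ d).
  apply: (turn _ _ _ _ _ c1a c12).
  by apply: IHz sz (guess_at_letter c2a) sy _; rewrite cat_rcons.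
Qed.

(** Guessing forever loses, so a winning play closes the block; [win_ind] collects the letters and
    separators it writes, at both program points at once. *)
Lemma win_completion c : existential c = ty i -> win (ty i) c ->
  forall xs x (j : J), size xs + j.+1 + sumn rest = sumn ns ->
  (guess_at c (Advance j) xs x 0 -> completion xs x j) /\
  (guess_at c (Choose j) xs x 1 -> completion xs x j).
Proof.
move: c; apply: win_ind => c c' cb cc' wc' IH xs x j sz; split=> ca.
  have [a [i' [l' [_ /rule_advanceE[-> -> ->] c'a]]]] := yields_rule ca cc'.
  apply: (IH _ _ _ _ sz).2; first exact: conf_at_ex c'a.
  by move: c'a; rewrite /guess_at addn1 addn0.
have [a [i' [l' [_ r c'a]]]] := yields_rule ca cc'.
move: r c'a; rewrite addn1 content_end => r c'a.
case: (rule_choose r) c'a => [[d [-> -> ->]]|[j' [jj' -> -> ->]]|[j0 cl]] c'a.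
- case: (IH (conf_at_ex c'a) xs (rcons x d) j sz) => /(_ (guess_at_letter c'a)).
  by case=> z [ys [sy ng]] _; exists (d :: z), ys; rewrite -(cat_rcons d).
- have sz' : size (rcons xs x) + j'.+1 + sumn rest = sumn ns.
    by move: sz; rewrite size_rcons jj' addSnnS.
  case: (IH (conf_at_ex c'a) _ [::] _ sz') => /(_ (guess_at_next c'a)).
  case=> z [ys [sy ng]] _; exists [::], (z :: ys); rewrite /= sy jj'.
  by split=> //; rewrite cats0 -cat_rcons.
- exists [::], [::]; split; first by [].
  rewrite cats0; apply/(wins_close _ cl c'a) => //.
  by move: sz; rewrite j0.
Qed.

End Block.

(** Induction on the number [r] of blocks after block [i]. *)
Lemma wins_block r i : i + r.+1 = k -> forall w xs x (j : J),
  size xs + j.+1 + sumn (drop i.+1 ns) = sumn ns ->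
  wins i (Advance j) (size (encode w (rcons xs x)))
    (content (encode w (rcons xs x))) (completion i w xs x j).
Proof.
elim: r i => [|r IH] i ir w xs x j sz c ca.
all: have ik : i < k by rewrite -ir addnS ltnS leq_addr.
all: have ca0 : guess_at i w c (Advance j) xs x 0 by rewrite /guess_at addn0.
all: have close_at : forall xs x c a i' l',
  size xs + 1 + sumn (drop i.+1 ns) = sumn ns -> closing i blank a i' l' ->
  let s := encode w (rcons xs x) in
  conf_at c i' l' (act_pos a (size s).+1)
    (act_cont a (size s).+1 (content s)) ->
  win (ty i) c <-> ~ game (~~ ty i) (drop i.+1 ns) (R w) (xs ++ [:: x]).
- move=> {sz ca ca0} {}xs {}x {}c a i' l' sz [ik2|ik2] s c'a.
    by move: ik2; rewrite -ir addn1 ltnn.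
  have drop0 : drop i.+1 ns = [::] by rewrite ik2 drop_size.
  rewrite drop0 -game_nil cats1; apply: (wins_return _ ik2).
    by rewrite size_rcons -sz drop0 addn0 addn1.
  by apply: conf_at_ext c'a => y; rewrite -(content_end s) act_cont_id.
- split=> [wc|]; last exact: completion_win sz ca0.
  exact: (@win_completion i w close_at c (conf_at_ex ca) wc xs x j sz).1 ca0.
- move=> {sz ca ca0} {}xs {}x {}c a i' l' sz [ik2|ik2] s c'a; last first.
    by move/eqP: ik2; rewrite -ir -addSnnS -[X in X == _]addn0 eqn_add2l.
  (* Closing passes the turn: the owner of block [i] wins iff the owner of block [i.+1] does not. *)
  rewrite -(negbK (ty i)) -tyS winN negbK.
  have dropE : drop i.+1 ns = nth 0 ns i.+1 :: drop i.+2 ns.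
    by rewrite -drop_nth.
  have n_gt0 : 0 < nth 0 ns i.+1.
    by rewrite lt0n; apply: contraNneq ns_gt0 => <-; rewrite mem_nth.
  rewrite dropE game_cons // cats1.
  have sz' : size (rcons xs x) + (block_count i.+1).+1 + sumn (drop i.+2 ns)
      = sumn ns.
    by rewrite block_countE prednK // size_rcons -addnA -sz dropE /= addn1.
  have {}ir : i.+1 + r.+1 = k by rewrite addSnnS.
  rewrite (IH _ ir w _ [::] _ sz') /completion ?block_countE //.
  rewrite encode_rcons0 size_rcons; apply: conf_at_ext c'a => y.
  exact: content_write.
- split=> [wc|]; last exact: completion_win sz ca0.
  exact: (@win_completion i w close_at c (conf_at_ex ca) wc xs x j sz).1 ca0.
Qed.

(** Induction on the number [n] of input letters still to be passed. Letters differ from the blank,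
    so every step is forced, and the blank after [w] becomes the first separator. *)
Lemma wins_scan w n X : 0 < k -> n <= size w ->
  wins 0 (Advance (block_count 0)) (size (@encode _ Delta w [:: [::]]))
     (content (encode w [:: [::]])) X ->
  wins 0 Scan (size w - n).+1 (content (encode w [::])) X.
Proof.
move=> k_gt0 nw H; have szw : size (@encode _ Delta w [::]) = size w.
  by rewrite /encode /= cats0 size_map.
elim: n nw => [|n IH] nw.
  rewrite subn0 -szw.
  have E := content_end (encode w [::]).
  apply: (@wins_forced _ _ _ _ (Write sharp) (Advance (block_count 0))) => //.
  - by apply: rule_first; rewrite E.
  - rewrite E => a1 i1 l1 r; inversion r; subst => //.
    match goal with NE : is_true (_ != _) |- _ => by rewrite eqxx in NE end.
  move: H; rewrite (encode_rcons0 w [::]) size_rcons; apply: wins_ext => y.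
  exact: content_write.
have lt_w : size w - n.+1 < size w.
  by rewrite ltn_subrL (leq_ltn_trans (leq0n n) nw).
have NE : (content (encode w [::]) (size w - n.+1).+1).1 != tm_emb T None.
  rewrite /content /encode /= cats0 -map_comp.
  case: w lt_w {H nw IH szw} => // a w lt_w; rewrite (nth_map a) //.
  by apply/eqP => /tm_emb_inj.
apply: (@wins_forced _ _ _ _ Forward Scan) => //.
- exact: rule_scan.
- move=> a1 i1 l1 r; inversion r; subst => //.
  by move/eqP: NE.
by rewrite /= subnSK //; apply: IH; apply: ltnW.
Qed.

Lemma guesser_accepts w : 0 < k ->
  accepts guesser w <-> quantify ex ns (R w) [::].
Proof.
move=> k_gt0.
pose f x := nth blank (blank :: [seq guess_emb (Some a) | a <- w]) x.
suff H : wins 0 Start 0 f (game ex ns (R w) [::]).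
  have ca : conf_at (init guesser w) 0 Start 0 f.
    by split; [| |exact: rep_start].
  move: (H _ ca); rewrite game_quantify /ty /= addbF /accepts.
  case: (ex) => // -[H1 H2].
  split=> h; apply: contrapT => nh; first exact: H2 nh h.
  exact: H1 nh h.
have E : game ex ns (R w) [::] <-> completion 0 w [::] [::] (block_count 0).
  have nsE : ns = nth 0 ns 0 :: drop 1 ns by rewrite -drop_nth // drop0.
  have n_gt0 : 0 < nth 0 ns 0.
    by rewrite lt0n; apply: contraNneq ns_gt0 => <-; rewrite mem_nth.
  by rewrite {1}nsE game_cons // /completion block_countE /ty /= addbF.
apply: (@wins_forced _ _ _ _ (Write (tm_emb T None, true)) Enter) => //.
- exact: rule_start.
- by move=> a1 i1 l1 r; inversion r.
apply: (@wins_ext _ _ _ _ (content (@encode _ Delta w [::]))) => [y|].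
  case: y => //= y; rewrite /content /f /encode /= cats0 -map_comp.
  case: (ltnP y (size w)) => yw; last by rewrite !nth_default ?size_map.
  by case: (w) yw => // a v yv; rewrite !(nth_map a).
apply: (@wins_forced _ _ _ _ Forward Scan) => //.
- exact: rule_enter.
- by move=> a1 i1 l1 r; inversion r.
have := @wins_scan w (size w) (game ex ns (R w) [::]) k_gt0 (leqnn _).
rewrite subnn; apply => c ca.
rewrite E; apply: (@wins_block k.-1 0 _ w [::] [::]) ca.
  by rewrite add0n prednK.
rewrite block_countE prednK ?lt0n; last first.
  by apply: contraNneq ns_gt0 => <-; rewrite mem_nth.
by rewrite add0n; case: (ns) k_gt0 => //= n ns' _; rewrite drop0.
Qed.

End Correctness.

(** The block index bounds the pivots seen so far: each rule raises it by at most one, the type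
    changes exactly when it rises, and it never exceeds [k]. *)
Lemma guesser_pivots : pivots_le guesser k.
Proof.
move=> w b [b0 bs] n; pose cnt n := count (pivot b) (iota 0 n).
have cntS m : cnt m.+1 = cnt m + pivot b m.
  by rewrite /cnt -addn1 iotaD count_cat /= addn0 add0n.
suff : if b n is Some c then exists i l p f, conf_at c i l p f /\ cnt n <= i
       else cnt n <= k.
  case: (b n) => // c [i [l [p [f [[ik _ _] ci]]]]]; exact: leq_trans ik.
elim: n => [|n IH].
  rewrite b0; exists 0, Start, 0; eexists; split; last by [].
  by split; [| |exact: rep_start].
rewrite cntS /pivot; move: (bs n) IH; case: (b n) => [c|]; last first.
  by case: (b n.+1) => // _ H; rewrite addn0.
case: (b n.+1) => [c'|] cc' [i [l [p [f [ca ci]]]]]; last first.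
  by rewrite addn0; apply: leq_trans ci _; case: ca.
have [a [i' [l' [ik r c'a]]]] := yields_rule ca cc'.
exists i', l'; eexists; eexists; split; first exact: c'a.
rewrite (conf_at_ex ca) (conf_at_ex c'a).
have [->|->] : i' = i \/ i' = i.+1.
- clear c'a.
  by case: r => [*|*|*|*|*|*|*|? ? ? ? ? _ [_|_]|*|*|*|*]; by [left | right].
- by rewrite eqxx addn0.
- by rewrite tyS; case: (ty i); rewrite addn1.
Qed.

End Guesser.

(** * Assembling the equivalences *)

Lemma arith_level_atm (Sigma : finType) ex k (L : seq Sigma -> Prop) :
  0 < k -> arith_level ex k L ->
  exists M : atm Sigma,
    [/\ ex_state (atm_start M) = ex, pivots_le M k,
        k = 1 -> forall (q : state M) g a q', ex_state q = ~~ ex ->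
          ~~ atm_delta q g a q' &
        forall w, L w <-> accepts M w].
Proof.
move=> k_gt0 [Delta [ns [R [sns ns_gt0 [T T_dec] LR]]]].
have exE i l : @ex_state _ (guesser ex ns T) (st ex i l) = ty ex i.
  by rewrite /st; case: ty.
exists (guesser ex ns T); split.
- by rewrite exE /ty addbF.
- by rewrite -sns; apply: guesser_pivots.
(* For [k = 1] only block [0], of type [ex], has transitions; this gives the extra clause on
   universal machines. *)
- move=> k1 q g a q' qex; apply/asboolP => -[i [l [i' [l' [ik _ qE _]]]]].
  move: qex ik; rewrite qE exE sns k1 ltnS leqn0 => + /eqP i0.
  by rewrite i0 /ty addbF; case: (ex).
- by move=> w; rewrite LR (guesser_accepts ex T_dec ns_gt0) // sns.
Qed.

Theorem theorem2p5 (Sigma : finType) (k : nat) (L : seq Sigma -> Prop) :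
  1 <= k ->
  (Sigma0 k L <->
     exists M : atm Sigma, is_Sigma M k /\ (forall w, L w <-> accepts M w)) /\
  (Pi0 k L <->
     exists M : atm Sigma, is_Pi M k /\ (forall w, L w <-> accepts M w)).
Proof.
have level_ext ex (L' : seq Sigma -> Prop) :
    (forall w, L w <-> L' w) -> arith_level ex k L' -> arith_level ex k L.
  move=> LL' [Delta [ns [R [? ? ? L'R]]]]; exists Delta, ns, R; split=> // w.
  by rewrite LL'.
move=> k_gt0; split; split.
- case/(arith_level_atm k_gt0) => M [Mex Mk _ LM].
  by exists M; split=> //; split; rewrite ?Mex.
- case=> M [[Mex Mk] LM]; apply: level_ext LM _.
  exact: atm_arith_level k_gt0 Mex Mk.
- case/(arith_level_atm k_gt0) => M [Mex Mk M1 LM].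
  by exists M; split=> //; split; rewrite ?Mex.
- case=> M [[/negbTE Mex Mk _] LM]; apply: level_ext LM _.
  exact: atm_arith_level k_gt0 Mex Mk.
Qed.
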